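(* Let $V$ be a unital Jordan superalgebra over a field $\mathbb{K}$ of characteristic different from $2$ and $3$. Then there are isomorphisms of Lie superalgebras $$\mathfrak{str}_w(V)\cong\widetilde{\mathfrak{str}}(V)\cong\mathfrak{str}(V).$$
   Context: $\mathbb{K}$ is a field of characteristic $\neq 2,3$. Super vector spaces $V=V_{\bar 0}\oplus V_{\bar 1}$ are not assumed finite dimensional; $|x|\in\mathbb{Z}/2\mathbb{Z}$ is the parity of a homogeneous $x$; formulas with signs are for homogeneous elements and extended linearly; $[A,B]=AB-(-1)^{|A||B|}BA$ is the supercommutator on $\mathrm{End}(V)$, $\mathfrak{gl}(V)$ is $\mathrm{End}(V)$ with this bracket, and $\mathfrak{gl}(V)^{op}$ is $\mathrm{End}(V)$ with the opposite bracket $[A,B]^{op}=-[A,B]$. A Jordan superalgebra is a super vector space $V$ with a bilinear product satisfying $V_iV_j\subset V_{i+j}$, $xy=(-1)^{|x||y|}yx$, and $(-1)^{|x||z|}[L_x,L_{yz}]+(-1)^{|y||x|}[L_y,L_{zx}]+(-1)^{|z||y|}[L_z,L_{xy}]=0$, where $L_x(y)=xy$. It is unital if there is $e\in V$ with $ex=x=xe$ for all $x$. $\mathrm{Der}(V)$ is the space of derivations, i.e. (spanned by homogeneous) $D\in\mathrm{End}(V)$ with $D(xy)=D(x)y+(-1)^{|x||D|}xD(y)$. The structure algebra is the Lie subsuperalgebra $\mathfrak{str}(V)=\{L_x\mid x\in V\}+\mathrm{Der}(V)\subset\mathfrak{gl}(V)$. Set $\{x,y,z\}=2\left((xy)z+x(yz)-(-1)^{|x||y|}y(xz)\right)$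 and $U_{x,y}:V\to V$, $z\mapsto(-1)^{|y||z|}\{x,z,y\}$. $\widetilde{\mathfrak{str}}(V)$ is the Lie subsuperalgebra of $\mathfrak{gl}(V)$ spanned by the homogeneous $X\in\mathfrak{gl}(V)$ such that for all homogeneous $a,b\in V$: $U_{X(a),b}+(-1)^{|X||a|}U_{a,X(b)}=XU_{a,b}+(-1)^{|X|(|a|+|b|)}U_{a,b}X^*$, where $X^*=-X+2L_{X(e)}$. $\mathfrak{str}_w(V)$ is the Lie subsuperalgebra of $\mathfrak{gl}(V)\oplus\mathfrak{gl}(V)^{op}$ spanned by the pairs $(X,Y)$, with $X,Y$ homogeneous of the same parity, such that for all homogeneous $a,b\in V$: $U_{X(a),b}+(-1)^{|X||a|}U_{a,X(b)}=XU_{a,b}+(-1)^{|Y|(|a|+|b|)}U_{a,b}Y$ and $U_{Y(a),b}+(-1)^{|Y||a|}U_{a,Y(b)}=YU_{a,b}+(-1)^{|X|(|a|+|b|)}U_{a,b}X$. *)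

(* Defs.v *)
From HB Require Import structures.
From mathcomp Require Import all_boot all_algebra.
From mathcomp Require Import all_classical.

Set Implicit Arguments.
Unset Strict Implicit.
Unset Printing Implicit Defensive.

Import GRing.Theory.
Local Open Scope classical_set_scope.
Local Open Scope ring_scope.

(* Parities are booleans (odd = true): addition in Z/2 is (+) and the product *)
(* is &&, so the Koszul sign (-1)^(|x||y|) reads (-1) ^+ (i && j).            *)

(* A grading V = V_0 (+) V_1 is given by its two projections; V_i is          *)
(* [homog V i] below. No dimension hypothesis is made.                        *)
HB.mixin Record Lmodule_isSuper (K : fieldType) V of GRing.Lmodule K V := {
  part : bool -> V -> V;
  part_is_linear : forall i, linear (part i);
  partK : forall i x, part i (part i x) = part i x;
  partN : forall i x, part i (part (~~ i) x) = 0;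
  part_sum : forall x, part false x + part true x = x
}.

#[short(type="superLmodType")]
HB.structure Definition SuperLmodule (K : fieldType) :=
  {V of Lmodule_isSuper K V & GRing.Lmodule K V}.

HB.instance Definition _ (K : fieldType) (V : superLmodType K) (i : bool) :=
  GRing.isLinear.Build K V V *:%R (part i) (@part_is_linear K V i).

Definition homog (K : fieldType) (V : superLmodType K) (i : bool) : set V :=
  [set x | part i x = x].
Arguments homog {K V} i.

Definition lspan (K : fieldType) (V : lmodType K) (P : set V) : set V :=
  [set x | exists n (c : 'I_n -> K) (v : 'I_n -> V),
     (forall k, P (v k)) /\ x = \sum_k c k *: v k].

Section SuperLmoduleTheory.
Context (K : fieldType) (V : superLmodType K).
Implicit Types (i j : bool) (x : V).

Lemma part_homog i x : homog i (part i x). Proof. exact: partK. Qed.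

Lemma part_homogN i j x : homog i x -> part j x = if i == j then x else 0.
Proof.
move=> <-; case: eqP => [<-|/eqP ij]; first by rewrite partK.
have -> : i = ~~ j by case: i ij; case: j.
by rewrite partN.
Qed.

Lemma part_sumb x : \sum_(i : bool) part i x = x.
Proof. by rewrite big_bool /= addrC part_sum. Qed.

End SuperLmoduleTheory.

Section SuperProduct.
Context (K : fieldType) (V W : superLmodType K).

Definition pair_part (i : bool) (x : V * W) : V * W := (part i x.1, part i x.2).

Let pair_part_is_linear i : linear (pair_part i).
Proof. by move=> a x y; rewrite /pair_part !linearP. Qed.
Let pair_partK i x : pair_part i (pair_part i x) = pair_part i x.
Proof. by rewrite /pair_part !partK. Qed.
Let pair_partN i x : pair_part i (pair_part (~~ i) x) = 0.
Proof. by rewrite /pair_part !partN. Qed.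
Let pair_part_sum x : pair_part false x + pair_part true x = x.
Proof. by case: x => x y; congr pair => /=; rewrite part_sum. Qed.

HB.instance Definition _ := Lmodule_isSuper.Build K (V * W)%type
  pair_part_is_linear pair_partK pair_partN pair_part_sum.

End SuperProduct.

(* Lie superalgebras; the field is meant to have characteristic <> 2, 3.      *)
HB.mixin Record Super_isLie (K : fieldType) L of SuperLmodule K L := {
  lie : L -> L -> L;
  lie_linear_l : forall y, linear (lie^~ y);
  lie_linear_r : forall x, linear (lie x);
  lie_homog : forall i j (x y : L),
    homog i x -> homog j y -> homog (i (+) j) (lie x y);
  lie_antisym : forall i j (x y : L), homog i x -> homog j y ->
    lie x y = - ((-1) ^+ (i && j) *: lie y x);
  lie_jacobi : forall i j k (x y z : L),
    homog i x -> homog j y -> homog k z ->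
    lie x (lie y z) = lie (lie x y) z + (-1) ^+ (i && j) *: lie y (lie x z)
}.

#[short(type="lieSuperType")]
HB.structure Definition LieSuper (K : fieldType) :=
  {L of Super_isLie K L & SuperLmodule K L}.

Notation "[ 'lie' x , y ]" := (lie x y) (at level 0, x, y at level 99).

Definition lie_iso (K : fieldType) (L M : lieSuperType K) : Prop :=
  exists f : {linear L -> M},
    [/\ bijective f,
        forall i x, f (part i x) = part i (f x) &
        forall x y, f [lie x, y] = [lie f x, f y]].

Record lie_sub (K : fieldType) (L : lieSuperType K) (S : set L) : Prop := {
  lie_sub0 : S 0;
  lie_subP : forall a x y, S x -> S y -> S (a *: x + y);
  lie_sub_part : forall i x, S x -> S (part i x);
  lie_sub_lie : forall x y, S x -> S y -> S [lie x, y]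
}.

Definition sub_lie (K : fieldType) (L : lieSuperType K) (S : set L)
  of lie_sub S : Type := {x : L | x \in S}.

Section SubLie.
Context (K : fieldType) (L : lieSuperType K) (S : set L) (hS : lie_sub S).
Local Notation T := (sub_lie hS).

HB.instance Definition _ := SubChoice.on T.

Let sub_lie_closed : subsemimod_closed (fun x : L => x \in S).
Proof.
split; first split.
- exact/mem_set/(lie_sub0 hS).
- move=> x y /set_mem Sx /set_mem Sy; apply/mem_set.
  by rewrite -[x]scale1r; exact: (lie_subP hS).
- move=> a x /set_mem Sx; apply/mem_set.
  by rewrite -[_ *: _]addr0; apply: (lie_subP hS) => //; exact: (lie_sub0 hS).
Qed.

HB.instance Definition _ :=
  GRing.SubChoice_isSubLmodule.Build K L _ T sub_lie_closed.

Let sub_part_subproof i (x : T) : part i (val x) \in S.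
Proof. exact/mem_set/(lie_sub_part hS)/set_mem/(valP x). Qed.
Let sub_lie_subproof (x y : T) : [lie val x, val y] \in S.
Proof. exact/mem_set/(lie_sub_lie hS (set_mem (valP x)))/set_mem/(valP y). Qed.

Definition sub_part i (x : T) : T := Sub (part i (val x)) (sub_part_subproof i x).
Definition sub_bracket (x y : T) : T := Sub [lie val x, val y] (sub_lie_subproof x y).

Let sub_part_is_linear i : linear (sub_part i).
Proof. by move=> a x y; apply: val_inj; rewrite linearP /= linearP. Qed.
Let sub_partK i x : sub_part i (sub_part i x) = sub_part i x.
Proof. by apply: val_inj; rewrite /= partK. Qed.
Let sub_partN i x : sub_part i (sub_part (~~ i) x) = 0.
Proof. by apply: val_inj; rewrite /= partN. Qed.
Let sub_part_sum x : sub_part false x + sub_part true x = x.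
Proof. by apply: val_inj; rewrite linearD /= part_sum. Qed.

HB.instance Definition _ := Lmodule_isSuper.Build K T
  sub_part_is_linear sub_partK sub_partN sub_part_sum.

Let sub_homog i (x : T) : homog i x <-> homog i (val x).
Proof.
split=> [/(congr1 val)//|h].
by exact: val_inj.
Qed.

Let sub_linear_l y : linear (sub_bracket^~ y).
Proof.
by move=> a x z; apply: val_inj; rewrite linearP /= lie_linear_l.
Qed.
Let sub_linear_r x : linear (sub_bracket x).
Proof.
by move=> a y z; apply: val_inj; rewrite linearP /= lie_linear_r.
Qed.
Let sub_lie_homog i j (x y : T) : homog i x -> homog j y ->
  homog (i (+) j) (sub_bracket x y).
Proof. by rewrite !sub_homog; exact: lie_homog. Qed.
Let sub_antisym i j (x y : T) : homog i x -> homog j y ->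
  sub_bracket x y = - ((-1) ^+ (i && j) *: sub_bracket y x).
Proof.
rewrite !sub_homog => hx hy; apply: val_inj.
by rewrite linearN linearZ /= scalerN; exact: (lie_antisym _ _ _ _ hx hy).
Qed.
Let sub_jacobi i j k (x y z : T) : homog i x -> homog j y -> homog k z ->
  sub_bracket x (sub_bracket y z) =
  sub_bracket (sub_bracket x y) z
  + (-1) ^+ (i && j) *: sub_bracket y (sub_bracket x z).
Proof.
rewrite !sub_homog => hx hy hz; apply: val_inj.
by rewrite linearD linearZ /=; exact: (lie_jacobi _ _ _ _ _ _ hx hy hz).
Qed.

HB.instance Definition _ := Super_isLie.Build K T
  sub_linear_l sub_linear_r sub_lie_homog sub_antisym sub_jacobi.

End SubLie.

Section LieProduct.
Context (K : fieldType) (L M : lieSuperType K).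

Definition pair_lie (x y : L * M) : L * M := ([lie x.1, y.1], [lie x.2, y.2]).

Let pair_homog i (x : L * M) : homog i x <-> homog i x.1 /\ homog i x.2.
Proof.
by case: x => x y; split=> [[hx hy]|[hx hy]]; last exact: congr2 hx hy.
Qed.

Let pair_linear_l y : linear (pair_lie^~ y).
Proof. by move=> a x z; rewrite /pair_lie !lie_linear_l. Qed.
Let pair_linear_r x : linear (pair_lie x).
Proof. by move=> a y z; rewrite /pair_lie !lie_linear_r. Qed.
Let pair_lie_homog i j (x y : L * M) : homog i x -> homog j y ->
  homog (i (+) j) (pair_lie x y).
Proof.
by rewrite !pair_homog => -[? ?] [? ?]; split; exact: lie_homog.
Qed.
Let pair_antisym i j (x y : L * M) : homog i x -> homog j y ->
  pair_lie x y = - ((-1) ^+ (i && j) *: pair_lie y x).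
Proof.
by rewrite !pair_homog => -[? ?] [? ?]; congr pair; exact: lie_antisym.
Qed.
Let pair_jacobi i j k (x y z : L * M) :
  homog i x -> homog j y -> homog k z ->
  pair_lie x (pair_lie y z) =
  pair_lie (pair_lie x y) z + (-1) ^+ (i && j) *: pair_lie y (pair_lie x z).
Proof.
by rewrite !pair_homog => -[? ?] [? ?] [? ?]; congr pair; apply: lie_jacobi;
  eassumption.
Qed.

HB.instance Definition _ := Super_isLie.Build K (L * M)%type
  pair_linear_l pair_linear_r pair_lie_homog pair_antisym pair_jacobi.

End LieProduct.

Definition lie_op (K : fieldType) (L : lieSuperType K) : Type := L.

Section LieOpposite.
Context (K : fieldType) (L : lieSuperType K).
Local Notation Lop := (lie_op L).

HB.instance Definition _ := SuperLmodule.on Lop.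

Definition op_lie (x y : Lop) : Lop := - [lie (x : L), (y : L)].

Let lie_oppr (x y : L) : [lie x, - y] = - [lie x, y].
Proof.
by have := lie_linear_r x (-1) y 0; rewrite addr0 !scaleN1r => ->;
  have := lie_linear_r x (-1) 0 0; rewrite scaler0 addr0 scaleN1r addNr => ->;
  rewrite addr0.
Qed.
Let lie_oppl (x y : L) : [lie - x, y] = - [lie x, y].
Proof.
by have := lie_linear_l y (-1) x 0; rewrite addr0 !scaleN1r => ->;
  have := lie_linear_l y (-1) 0 0; rewrite scaler0 addr0 scaleN1r addNr => ->;
  rewrite addr0.
Qed.

Let op_linear_l y : linear (op_lie^~ y).
Proof. by move=> a x z; rewrite /op_lie lie_linear_l opprD scalerN. Qed.
Let op_linear_r x : linear (op_lie x).
Proof. by move=> a y z; rewrite /op_lie lie_linear_r opprD scalerN. Qed.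
Let op_homog i j (x y : Lop) : homog i x -> homog j y ->
  homog (i (+) j) (op_lie x y).
Proof.
move=> hx hy; rewrite /homog/= /op_lie linearN; congr (- _).
exact: (@lie_homog K L).
Qed.
Let op_antisym i j (x y : Lop) : homog i x -> homog j y ->
  op_lie x y = - ((-1) ^+ (i && j) *: op_lie y x).
Proof.
move=> hx hy; rewrite /op_lie scalerN; congr (- _).
exact: (@lie_antisym K L).
Qed.
Let op_jacobi i j k (x y z : Lop) : homog i x -> homog j y -> homog k z ->
  op_lie x (op_lie y z) =
  op_lie (op_lie x y) z + (-1) ^+ (i && j) *: op_lie y (op_lie x z).
Proof.
move=> hx hy hz; rewrite /op_lie !(lie_oppr, lie_oppl) !opprK.
exact: (@lie_jacobi K L _ _ k).
Qed.

HB.instance Definition _ := Super_isLie.Build K Lop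
  op_linear_l op_linear_r op_homog op_antisym op_jacobi.

End LieOpposite.

Definition End (K : fieldType) (V : lmodType K) : Type := {linear V -> V}.

Section EndLmodule.
Context (K : fieldType) (V : lmodType K).
Implicit Types f g h : End V.

HB.instance Definition _ := gen_eqMixin (End V).
HB.instance Definition _ := gen_choiceMixin (End V).

Lemma EndP f g : f =1 g -> f = g.
Proof.
move=> fg; have {fg} : (f : V -> V) = g by apply/funext.
case: f g => [f [[[? ?]] [?]]] [g [[[? ?]] [?]]] /= fg.
by subst g; do 2 f_equal; rewrite ?(Prop_irrelevance _ _) //; f_equal;
   f_equal; exact: Prop_irrelevance.
Qed.

Definition End0 : End V := (\0 : {linear V -> V}).
Definition Endopp f : End V := (\- f : {linear V -> V}).
Definition Endadd f g : End V := (f \+ g : {linear V -> V}).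
Definition Endscale (a : K) f : End V := (a \*: f : {linear V -> V}).
Definition Endcomp f g : End V := (f \o g : {linear V -> V}).

Let EndaddA : associative Endadd.
Proof. by move=> f g h; apply: EndP => x /=; rewrite addrA. Qed.
Let EndaddC : commutative Endadd.
Proof. by move=> f g; apply: EndP => x /=; rewrite addrC. Qed.
Let Endadd0 : left_id End0 Endadd.
Proof. by move=> f; apply: EndP => x /=; rewrite add0r. Qed.
Let EndaddN : left_inverse End0 Endopp Endadd.
Proof. by move=> f; apply: EndP => x /=; rewrite addNr. Qed.

HB.instance Definition _ :=
  GRing.isZmodule.Build (End V) EndaddA EndaddC Endadd0 EndaddN.

Let EndscaleA a b f : Endscale a (Endscale b f) = Endscale (a * b) f.
Proof. by apply: EndP => x /=; rewrite scalerA. Qed.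
Let Endscale1 : left_id 1 Endscale.
Proof. by move=> f; apply: EndP => x /=; rewrite scale1r. Qed.
Let EndscaleDr : right_distributive Endscale +%R.
Proof. by move=> a f g; apply: EndP => x /=; rewrite scalerDr. Qed.
Let EndscaleDl f a b : Endscale (a + b) f = Endscale a f + Endscale b f.
Proof. by apply: EndP => x /=; rewrite scalerDl. Qed.

HB.instance Definition _ := GRing.Zmodule_isLmodule.Build K (End V)
  EndscaleA Endscale1 EndscaleDr EndscaleDl.

Lemma End0E x : (0 : End V) x = 0. Proof. by []. Qed.
Lemma EndoppE f x : (- f) x = - f x. Proof. by []. Qed.
Lemma EndaddE f g x : (f + g) x = f x + g x. Proof. by []. Qed.
Lemma EndscaleE a f x : (a *: f) x = a *: f x. Proof. by []. Qed.
Lemma EndcompE f g x : Endcomp f g x = f (g x). Proof. by []. Qed.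
Definition EndE := (End0E, EndoppE, EndaddE, EndscaleE, EndcompE).

End EndLmodule.

Section EndSuper.
Context (K : fieldType) (V : superLmodType K).
Implicit Types f g h : End V.

Definition proj (i : bool) : End V := (part i : {linear V -> V}).

(* The component of degree i of f maps each V_j to V_(i+j).                   *)
Definition End_part (i : bool) f : End V :=
  \sum_(j : bool) Endcomp (proj (i (+) j)) (Endcomp f (proj j)).

Lemma End_partE i f x :
  End_part i f x = part (~~ i) (f (part true x)) + part i (f (part false x)).
Proof. by rewrite /End_part big_bool /= addbT addbF. Qed.

Let part_part i j (x : V) : part i (part j x) = if i == j then part i x else 0.
Proof.
by rewrite (part_homogN _ (part_homog j x)) eq_sym; case: eqP => // ->.
Qed.

Let End_part_is_linear i : linear (End_part i).
Proof.
move=> a f g; apply: EndP => x.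
by rewrite !(End_partE, EndE) !linearP scalerDr addrACA.
Qed.
Let End_partK i f : End_part i (End_part i f) = End_part i f.
Proof.
apply: EndP => x /=; rewrite !End_partE !raddfD /= !part_part.
by case: i => /=; rewrite ?raddf0 ?(addr0, add0r).
Qed.
Let End_partN i f : End_part i (End_part (~~ i) f) = 0.
Proof.
apply: EndP => x /=; rewrite !End_partE !raddfD /= !part_part.
by case: i => /=; rewrite ?raddf0 ?(addr0, add0r).
Qed.
Let End_part_sum f : End_part false f + End_part true f = f.
Proof.
apply: EndP => x; rewrite EndaddE !End_partE /= addrACA.
rewrite part_sum (addrC (part true _)) part_sum.
by rewrite -raddfD addrC part_sum.
Qed.

HB.instance Definition _ := Lmodule_isSuper.Build K (End V)
  End_part_is_linear End_partK End_partN End_part_sum.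

Lemma homog_EndP i f :
  homog i f <-> (forall j x, homog j x -> homog (i (+) j) (f x)).
Proof.
split=> [hf j x hx|hf].
  have := congr1 (fun g : End V => g x) hf; rewrite [LHS]End_partE => <-.
  rewrite !(part_homogN _ hx); case: {hf hx} j => /=; rewrite !raddf0.
    by rewrite addr0 addbT; exact: part_homog.
  by rewrite add0r addbF; exact: part_homog.
apply: EndP => x; rewrite [LHS]End_partE.
have /= := hf true _ (part_homog true x); rewrite addbT => ->.
have /= := hf false _ (part_homog false x); rewrite addbF => ->.
by rewrite -raddfD addrC part_sum.
Qed.

(* [A, B] = A B - (-1)^(|A||B|) B A, extended bilinearly.                     *)
Definition supercomm f g : End V := Endcomp f g -
  \sum_(i : bool) \sum_(j : bool)
    (-1) ^+ (i && j) *: Endcomp (part j g) (part i f).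

Lemma supercommE i j f g x : homog i f -> homog j g ->
  supercomm f g x = f (g x) - (-1) ^+ (i && j) *: g (f x).
Proof.
move=> hf hg; rewrite /supercomm !big_bool /= !(part_homogN _ hf) !(part_homogN _ hg).
case: i j {hf hg} => [] [] /=;
  by rewrite ?raddf0 ?scaler0 ?(addr0, add0r).
Qed.

Let supercomm_linear_l g : linear (supercomm^~ g).
Proof.
move=> a f h; apply: EndP => x; rewrite /supercomm !big_bool /=.
rewrite !linearP /= scalerBr !scalerDr [RHS]addrACA -opprD; congr (_ - _).
by rewrite [X in X + _ = _]addrACA [X in _ + X = _]addrACA [LHS]addrACA.
Qed.
Let supercomm_linear_r f : linear (supercomm f).
Proof.
move=> a g h; apply: EndP => x; rewrite /supercomm !big_bool /=.
rewrite !linearP /= scalerBr !scalerDr [RHS]addrACA -opprD; congr (_ - _).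
by rewrite [X in X + _ = _]addrACA [X in _ + X = _]addrACA [LHS]addrACA.
Qed.
Let supercomm_homog i j f g : homog i f -> homog j g ->
  homog (i (+) j) (supercomm f g).
Proof.
move=> hf hg; apply/homog_EndP => k x hx; rewrite (supercommE _ hf hg).
move: hf hg => /homog_EndP hf /homog_EndP hg.
have := hf _ _ (hg _ _ hx); have := hg _ _ (hf _ _ hx).
rewrite /homog/= addbCA addbA => h1 h2.
by rewrite linearB linearZ /= h1 h2.
Qed.

Let signK (b : bool) : (-1) ^+ b * (-1) ^+ b = 1 :> K.
Proof. by case: b; rewrite ?mulr1 // expr1 mulrNN mulr1. Qed.
Let sign_addr (i j k : bool) :
  (-1) ^+ (i && (j (+) k)) = (-1) ^+ (i && j) * (-1) ^+ (i && k) :> K.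
Proof. by case: i j k => [] [] []; rewrite ?mulr1 ?mul1r // mulrNN mulr1. Qed.
Let sign_addl (i j k : bool) :
  (-1) ^+ ((i (+) j) && k) = (-1) ^+ (i && k) * (-1) ^+ (j && k) :> K.
Proof. by rewrite andbC sign_addr !(andbC k). Qed.

Let supercomm_antisym i j f g : homog i f -> homog j g ->
  supercomm f g = - ((-1) ^+ (i && j) *: supercomm g f).
Proof.
move=> hf hg; apply: EndP => x.
rewrite EndoppE EndscaleE (supercommE _ hf hg) (supercommE _ hg hf) andbC.
by rewrite scalerBr scalerA signK scale1r opprB.
Qed.

Let jacobi_aux (p q r : K) (a b c d e f : V) : p * p = 1 ->
  a - r *: b - (p * q) *: (c - r *: d) =
  a - p *: e - (q * r) *: (f - p *: d)
  + p *: (e - q *: c - (p * r) *: (b - q *: f)).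
Proof.
move=> p2; rewrite !scalerBr !scalerA !mulrA p2 mul1r.
rewrite [RHS]addrAC -[p *: e - _ - _]addrA [X in _ = X - _]addrA subrK.
rewrite (mulrC r q) (mulrC _ p) mulrA !opprB !addrA.
rewrite (addrAC _ ((q * r) *: f)) (addrAC _ ((q * r) *: f)) addrK.
by rewrite (addrAC a (- (p * q *: c))) [RHS]addrAC.
Qed.

Let supercomm_jacobi i j k f g h : homog i f -> homog j g -> homog k h ->
  supercomm f (supercomm g h) =
  supercomm (supercomm f g) h + (-1) ^+ (i && j) *: supercomm g (supercomm f h).
Proof.
move=> hf hg hh; apply: EndP => x; rewrite EndaddE EndscaleE.
rewrite (supercommE _ hf (supercomm_homog hg hh)).
rewrite (supercommE _ (supercomm_homog hf hg) hh).
rewrite (supercommE _ hg (supercomm_homog hf hh)).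
rewrite !(supercommE _ hf hg, supercommE _ hf hh, supercommE _ hg hh).
rewrite sign_addl !sign_addr !(andbC j i).
rewrite ![f (_ - _)]linearB ![f (_ *: _)]linearZ.
rewrite ![g (_ - _)]linearB ![g (_ *: _)]linearZ.
rewrite ![h (_ - _)]linearB ![h (_ *: _)]linearZ /=.
by apply: jacobi_aux; exact: signK.
Qed.

HB.instance Definition _ := Super_isLie.Build K (End V) supercomm_linear_l
  supercomm_linear_r supercomm_homog supercomm_antisym supercomm_jacobi.

End EndSuper.

HB.mixin Record Super_isAlgebra (K : fieldType) V of SuperLmodule K V := {
  smul : V -> V -> V;
  smul_linear_l : forall y, linear (smul^~ y);
  smul_linear_r : forall x, linear (smul x);
  smul_homog : forall i j (x y : V),
    homog i x -> homog j y -> homog (i (+) j) (smul x y)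
}.

#[short(type="superAlgType")]
HB.structure Definition SuperAlgebra (K : fieldType) :=
  {V of Super_isAlgebra K V & SuperLmodule K V}.

Notation "x ** y" := (smul x y) (at level 40, left associativity) : ring_scope.

HB.instance Definition _ (K : fieldType) (V : superAlgType K) (x : V) :=
  GRing.isLinear.Build K V V *:%R (smul x) (smul_linear_r x).

Definition Lop (K : fieldType) (V : superAlgType K) (x : V) : End V :=
  (smul x : {linear V -> V}).

HB.mixin Record SuperAlgebra_isJordan (K : fieldType) V of SuperAlgebra K V := {
  jordan_comm : forall i j (x y : V), homog i x -> homog j y ->
    x ** y = (-1) ^+ (i && j) *: (y ** x);
  jordan_identity : forall i j k (x y z : V),
    homog i x -> homog j y -> homog k z ->
    (-1) ^+ (i && k) *: [lie Lop x, Lop (y ** z)]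
    + (-1) ^+ (j && i) *: [lie Lop y, Lop (z ** x)]
    + (-1) ^+ (k && j) *: [lie Lop z, Lop (x ** y)] = 0
}.

#[short(type="jordanSuperType")]
HB.structure Definition JordanSuper (K : fieldType) :=
  {V of SuperAlgebra_isJordan K V & SuperAlgebra K V}.

Definition is_unity (K : fieldType) (V : superAlgType K) (e : V) : Prop :=
  forall x, e ** x = x /\ x ** e = x.

Section StructureAlgebras.
Context (K : fieldType) (V : jordanSuperType K).
Implicit Types (x y z a b e : V) (X Y D : End V).

(* 2((xy)z + x(yz) - (-1)^(|x||y|) y(xz)), extended trilinearly.              *)
Definition triple x y z : V :=
  2 *: ((x ** y) ** z + x ** (y ** z)
        - \sum_(i : bool) \sum_(j : bool)
            (-1) ^+ (i && j) *: (part j y ** (part i x ** z))).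

(* U_(x,y)(z) = (-1)^(|y||z|) {x, z, y}, extended trilinearly.                *)
Definition Uop x y z : V :=
  \sum_(j : bool) \sum_(k : bool)
    (-1) ^+ (j && k) *: triple x (part k z) (part j y).

Let smul0l y : 0 ** y = 0.
Proof.
by have := smul_linear_l y (-1) 0 0; rewrite scaler0 addr0 scaleN1r addNr.
Qed.

Lemma tripleE i j x y z : homog i x -> homog j y ->
  triple x y z =
  2 *: ((x ** y) ** z + x ** (y ** z) - (-1) ^+ (i && j) *: (y ** (x ** z))).
Proof.
move=> hx hy; rewrite /triple !big_bool /= !(part_homogN _ hx) !(part_homogN _ hy).
by case: i j {hx hy} => [] [];
  rewrite /= ?(smul0l, linear0, scaler0, addr0, add0r).
Qed.

Lemma UopE j k x y z : homog j y -> homog k z ->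
  Uop x y z = (-1) ^+ (j && k) *: triple x z y.
Proof.
have t0l w : triple x 0 w = 0.
  by rewrite /triple !big_bool /= !(smul0l, linear0, scaler0, addr0, subr0).
have t0r w : triple x w 0 = 0.
  by rewrite /triple !big_bool /= !(smul0l, linear0, scaler0, addr0, subr0).
move=> hy hz; rewrite /Uop !big_bool /= !(part_homogN _ hy) !(part_homogN _ hz).
by case: j k {hy hz} => [] []; rewrite /= ?(t0l, t0r, scaler0, addr0, add0r).
Qed.

Definition Der : set (End V) := lspan [set D : End V | exists2 p, homog p D &
  forall i j x y, homog i x -> homog j y ->
    D (x ** y) = D x ** y + (-1) ^+ (i && p) *: (x ** D y)].

Definition str : set (End V) :=
  [set A | exists x D, Der D /\ A = Lop x + D].

Definition Xstar e X : End V := - X + 2 *: Lop (X e).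

Definition strt e : set (End V) := lspan [set X : End V | exists2 p, homog p X &
  forall i j a b, homog i a -> homog j b -> forall z,
    Uop (X a) b z + (-1) ^+ (p && i) *: Uop a (X b) z =
    X (Uop a b z) + (-1) ^+ (p && (i (+) j)) *: Uop a b (Xstar e X z)].

Definition strw : set (End V * lie_op (End V)) :=
  lspan [set XY | exists2 p, homog p XY.1 /\ homog p XY.2 &
    let X : End V := XY.1 in let Y : End V := XY.2 in
    forall i j a b, homog i a -> homog j b ->
    (forall z, Uop (X a) b z + (-1) ^+ (p && i) *: Uop a (X b) z =
       X (Uop a b z) + (-1) ^+ (p && (i (+) j)) *: Uop a b (Y z)) /\
    (forall z, Uop (Y a) b z + (-1) ^+ (p && i) *: Uop a (Y b) z =
       Y (Uop a b z) + (-1) ^+ (p && (i (+) j)) *: Uop a b (X z))].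

End StructureAlgebras.

Arguments str {K} V.
Arguments strw {K} V.

(* Main.v *)
From HB Require Import structures.
Require Import Defs.
From mathcomp Require Import all_boot all_algebra.
From mathcomp Require Import all_classical.

Set Implicit Arguments.
Unset Strict Implicit.
Unset Printing Implicit Defensive.

Import GRing.Theory.
Local Open Scope classical_set_scope.
Local Open Scope ring_scope.

(** For x in V and a derivation D, write U_(a,b) = 2 (L_a L_b +- L_b L_a - L_(ab)).

   Supercommutativity and the Jordan identity give two facts: [L_x, L_y] is a derivation
   ([lie_Lop_derivation]), and L_x satisfies the fundamental identity
   U_(xa, b) +- U_(a, xb) = L_x U_(a,b) +- U_(a,b) L_x ([Lop_fundamental]).
   A derivation D satisfies the same identity with (D, -D) in place of
   (L_x, L_x), so every X = L_x + D satisfies the two conditions of str_w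
   together with Y = L_x - D, which is X^* since X(e) = x ([Xstar_cond]).

   Conversely, in characteristic other than 2, the condition at a = b = e forces
   Y = X^* ([Ucond_Xstar]). If X satisfies the condition with X^*, then
   D = X - L_(X e) satisfies it with -D and kills e; as U_(a,e) = 2 L_a, the
   condition at b = e is the Leibniz rule for D ([Ucond_str_homog]).

   Hence the structure algebra and its tilde version are the same subspace, the
   span of the homogeneous L_x + D ([strt_lspan], [str_lspan]), while str_w is
   the graph of X |-> X^* on it ([strw_sub], [strt_strw]). This map is a morphism
   to the opposite algebra ([Xstar_lie]), so the graph is a subalgebra and the
   first projection is the isomorphism sought. *)

(** * Deciding linear identities in abelian groups *)

(** Formal Z-linear combinations of the entries of an environment; an index out of
   range stands for 0. *)
Inductive zexpr := ZVar of nat | ZZero | ZAdd of zexpr & zexpr | ZOpp of zexpr.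

Fixpoint zeval (V : zmodType) (env : seq V) (t : zexpr) : V :=
  match t with
  | ZVar n => nth 0 env n
  | ZZero => 0
  | ZAdd u v => zeval env u + zeval env v
  | ZOpp u => - zeval env u
  end.

Fixpoint zcoef (t : zexpr) (i : nat) : int :=
  match t with
  | ZVar n => (n == i)%:Z
  | ZZero => 0
  | ZAdd u v => zcoef u i + zcoef v i
  | ZOpp u => - zcoef u i
  end.

Lemma zeval_coef (V : zmodType) (env : seq V) t :
  zeval env t = \sum_(i < size env) nth 0 env i *~ zcoef t i.
Proof.
elim: t => /= [n||u -> v ->|u ->].
- case: (ltnP n (size env)) => [ltn|gen].
    rewrite (bigD1 (Ordinal ltn)) //= eqxx big1 ?addr0 // => i.
    by rewrite -val_eqE /= eq_sym => /negbTE ->.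
  rewrite nth_default // big1 // => i _.
  by rewrite gtn_eqF // (leq_trans (ltn_ord i)).
- by rewrite big1.
- by rewrite -big_split; apply: eq_bigr => i _; rewrite mulrzDr.
- by rewrite -sumrN; apply: eq_bigr => i _; rewrite mulrNz.
Qed.

Lemma zeval_eq (V : zmodType) (env : seq V) t u :
  all (fun i => zcoef t i == zcoef u i) (iota 0 (size env)) ->
  zeval env t = zeval env u.
Proof.
move=> /allP h; rewrite !zeval_coef; apply: eq_bigr => i _.
have /h /eqP -> // : (i : nat) \in iota 0 (size env).
by rewrite mem_iota /= ltn_ord.
Qed.

(* Atoms are compared up to conversion, as the algebraic structures occurring in
   them may be reached along different inheritance paths. *)
Ltac zmem t env :=
  lazymatch env with
  | nil => constr:(false)
  | cons ?a ?env' =>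
    match constr:(Set) with
    | _ => let _ := match constr:(Set) with _ => unify t a end in constr:(true)
    | _ => zmem t env'
    end
  end.
Ltac zatoms env t :=
  lazymatch t with
  | GRing.add ?a ?b => let env' := zatoms env a in zatoms env' b
  | GRing.opp ?a => zatoms env a
  | GRing.zero => env
  | _ => lazymatch zmem t env with
         | true => env | false => constr:(cons t env) end
  end.
Ltac zindex t env :=
  match env with
  | cons ?a _ =>
    let _ := match constr:(Set) with _ => unify t a end in constr:(O)
  | cons _ ?env' => let n := zindex t env' in constr:(S n)
  end.
Ltac zreify env t :=
  lazymatch t with
  | GRing.add ?a ?b =>
      let u := zreify env a in let v := zreify env b in constr:(ZAdd u v)
  | GRing.opp ?a => let u := zreify env a in constr:(ZOpp u)
  | GRing.zero => constr:(ZZero)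
  | _ => let n := zindex t env in constr:(ZVar n)
  end.

(** Proves an equality that holds in every abelian group. *)
Ltac zmod :=
  lazymatch goal with
  | |- @eq ?T ?a ?b =>
    let env := zatoms (@nil T) a in let env := zatoms env b in
    let u := zreify env a in let v := zreify env b in
    apply: (@zeval_eq _ env u v); vm_compute; reflexivity
  end.

Lemma eq_from_sub (V : zmodType) (a b c d : V) :
  c = d -> a - b = c - d -> a = b.
Proof. by move=> -> /eqP; rewrite subrr subr_eq0 => /eqP. Qed.

(** Proves a = b from [E] : c = d when a - b equals c - d or d - c in every abelian
   group. *)
Ltac zmod_using E :=
  first [apply: (eq_from_sub E); cbv beta; zmod
        | apply: (eq_from_sub (esym E)); cbv beta; zmod].

(** * Operator identities in Jordan superalgebras *)

Section SuperAlgebraTheory.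
Context (K : fieldType) (V : superAlgType K).
Implicit Types x y z : V.

Lemma smulDl x y z : (x + y) ** z = x ** z + y ** z.
Proof. by have := smul_linear_l z 1 x y; rewrite !scale1r. Qed.
Lemma smul0l z : 0 ** z = 0.
Proof. by apply: (addrI (0 ** z)); rewrite -smulDl !addr0. Qed.
Lemma smulZl c x z : (c *: x) ** z = c *: (x ** z).
Proof. by have := smul_linear_l z c x 0; rewrite !smul0l !addr0. Qed.
Lemma smulNl x z : (- x) ** z = - (x ** z).
Proof. by rewrite -!scaleN1r smulZl. Qed.
Lemma smulDr x y z : z ** (x + y) = z ** x + z ** y.
Proof. exact: linearD. Qed.
Lemma smulNr x z : z ** (- x) = - (z ** x).
Proof. exact: linearN. Qed.
Lemma smulZr c x z : z ** (c *: x) = c *: (z ** x).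
Proof. exact: linearZ. Qed.
Lemma smul0r z : z ** 0 = 0.
Proof. exact: linear0. Qed.

Lemma homog_Lop i x : homog i x -> homog i (Lop x).
Proof. by move=> hx; apply/homog_EndP => j y; exact: smul_homog. Qed.

End SuperAlgebraTheory.

Lemma eq_on_homog (K : fieldType) (V : superLmodType K) (f g : End V) :
  (forall i x, homog i x -> f x = g x) -> f = g.
Proof.
move=> h; apply: EndP => x; rewrite -(part_sum x) !linearD.
by congr (_ + _); apply: h; exact: part_homog.
Qed.

Lemma homog_End (K : fieldType) (V : superLmodType K) i p (D : End V) (x : V) :
  homog p D -> homog i x -> homog (p (+) i) (D x).
Proof. by move=> /homog_EndP; exact. Qed.

Lemma homogD (K : fieldType) (W : superLmodType K) p (u v : W) :
  homog p u -> homog p v -> homog p (u + v).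
Proof. by move=> hu hv; rewrite /homog/= linearD; congr (_ + _). Qed.

Lemma homogN (K : fieldType) (W : superLmodType K) p (u : W) :
  homog p u -> homog p (- u).
Proof. by move=> hu; rewrite /homog/= linearN; congr (- _). Qed.

Lemma homogZ (K : fieldType) (W : superLmodType K) p c (u : W) :
  homog p u -> homog p (c *: u).
Proof. by move=> hu; rewrite /homog/= linearZ; congr (_ *: _). Qed.

Definition smulE := (smulDl, smulDr, smulNl, smulNr, smul0l, smul0r).

(* Evaluates the signs once the parities are known. *)
Ltac signs := rewrite /= ?(expr0, expr1, scale1r, scaleN1r, opprK, smulE).

Section JordanIdentities.
Context (K : fieldType) (V : jordanSuperType K).
Implicit Types x y z w a b : V.
Local Notation "'sg' b" := ((-1) ^+ b : K) (at level 8, b at level 1).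

(** The defining identity applied to w, multiplied by (-1)^(|x||z|) so that all the
   signs are Koszul signs relative to the order x, y, z. *)
Lemma jordan_vec i j k x y z w : homog i x -> homog j y -> homog k z ->
  x ** ((y ** z) ** w)
  + sg (i && (j (+) k)) *: (y ** ((z ** x) ** w))
  + sg (k && (i (+) j)) *: (z ** ((x ** y) ** w)) =
  sg (i && (j (+) k)) *: ((y ** z) ** (x ** w))
  + sg (k && (i (+) j)) *: ((z ** x) ** (y ** w))
  + (x ** y) ** (z ** w).
Proof.
move=> hx hy hz.
have ev (p q r : K) (f g h : End V) : p *: f + q *: g + r *: h = 0 ->
    p *: f w + q *: g w + r *: h w = 0.
  by move/(congr1 (fun f : End V => f w)).
have {ev} := ev _ _ _ _ _ _ (jordan_identity _ _ _ _ _ _ hx hy hz).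
have H (p q : bool) (u v : V) : homog p u -> homog q v ->
    [lie Lop u, Lop v] w = u ** (v ** w) - sg (p && q) *: (v ** (u ** w)).
  by move=> hu hv; rewrite -(supercommE _ (homog_Lop hu) (homog_Lop hv)).
rewrite (H _ _ _ _ hx (smul_homog _ _ _ _ hy hz)).
rewrite (H _ _ _ _ hy (smul_homog _ _ _ _ hz hx)).
rewrite (H _ _ _ _ hz (smul_homog _ _ _ _ hx hy)) => {hx hy hz}.
case: i; case: j; case: k; signs => E; zmod_using E.
Qed.

(** The Jordan identity as a trilinear identity between operators applied to z: by
   commutativity it is [jordan_vec] for x, z, b evaluated at a. *)
Lemma jordan_op i j k x a b z : homog i x -> homog j a -> homog k b ->
  x ** (a ** (b ** z))
  + sg ((i && (j (+) k)) (+) (j && k)) *: (b ** (a ** (x ** z)))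
  + sg (j && k) *: (((x ** b) ** a) ** z) =
  (x ** a) ** (b ** z) + sg (j && k) *: ((x ** b) ** (a ** z))
  + sg (i && (j (+) k)) *: ((a ** b) ** (x ** z)).
Proof.
move=> hx ha hb.
pose f : End V := Endcomp (Lop x) (Endcomp (Lop a) (Lop b))
  + sg ((i && (j (+) k)) (+) (j && k)) *: Endcomp (Lop b) (Endcomp (Lop a) (Lop x))
  + sg (j && k) *: Lop ((x ** b) ** a).
pose g : End V := Endcomp (Lop (x ** a)) (Lop b)
  + sg (j && k) *: Endcomp (Lop (x ** b)) (Lop a)
  + sg (i && (j (+) k)) *: Endcomp (Lop (a ** b)) (Lop x).
suff /(congr1 (fun f : End V => f z)) : f = g by [].
apply: eq_on_homog => {z} l z hz; rewrite {}/f {}/g !EndE.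
have hM p q (u v : V) : homog p u -> homog q v -> homog (p (+) q) (u ** v).
  exact: smul_homog.
have := jordan_vec a hx hz hb.
rewrite (jordan_comm _ _ _ _ (hM _ _ _ _ hz hb) ha).
rewrite (jordan_comm _ _ _ _ hz (hM _ _ _ _ (hM _ _ _ _ hb hx) ha)).
rewrite (jordan_comm _ _ _ _ (hM _ _ _ _ hx hz) ha).
rewrite (jordan_comm _ _ _ _ (hM _ _ _ _ hz hb) (hM _ _ _ _ hx ha)).
rewrite (jordan_comm _ _ _ _ (hM _ _ _ _ hx hz) (hM _ _ _ _ hb ha)).
rewrite (jordan_comm _ _ _ _ hz hb) (jordan_comm _ _ _ _ hb hx).
rewrite (jordan_comm _ _ _ _ hz ha) (jordan_comm _ _ _ _ hb ha).
case: i {hx}; case: j {ha}; case: k {hb}; case: l {hz}; signs => E;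
  zmod_using E.
Qed.

(** [L_x, L_a] is a derivation: compare [jordan_op] for x, a, b and for a, x, b,
   whose right-hand sides agree up to the sign (-1)^(|x||a|). *)
Lemma lie_Lop_derivation i j k x a b z : homog i x -> homog j a -> homog k b ->
  x ** (a ** (b ** z)) - sg (i && j) *: (a ** (x ** (b ** z))) =
  (x ** (a ** b) - sg (i && j) *: (a ** (x ** b))) ** z
  + sg ((i (+) j) && k) *:
      (b ** (x ** (a ** z) - sg (i && j) *: (a ** (x ** z)))).
Proof.
move=> hx ha hb.
have E1 := jordan_op z hx ha hb; have E2 := jordan_op z ha hx hb.
have := congr2 (fun u v => u - sg (i && j) *: v) E1 E2 => {E1 E2} /=.
rewrite (jordan_comm _ _ _ _ (smul_homog _ _ _ _ hx hb) ha).
rewrite (jordan_comm _ _ _ _ (smul_homog _ _ _ _ ha hb) hx).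
rewrite (jordan_comm _ _ _ _ ha hx).
case: i {hx}; case: j {ha}; case: k {hb}; signs => E; zmod_using E.
Qed.

(** The identity U_(xa, b) +- U_(a, xb) = L_x U_(a,b) +- U_(a,b) L_x without its
   factor 2. It is the combination of [jordan_op] for x, a, b, [jordan_op] for
   x, b, a and [jordan_vec] for x, a, b. *)
Lemma Lop_fundamental i j k x a b z : homog i x -> homog j a -> homog k b ->
  ((x ** a) ** (b ** z) + sg ((i (+) j) && k) *: (b ** ((x ** a) ** z))
   - ((x ** a) ** b) ** z)
  + sg (i && j) *:
    (a ** ((x ** b) ** z) + sg (j && (i (+) k)) *: ((x ** b) ** (a ** z))
     - (a ** (x ** b)) ** z) =
  x ** (a ** (b ** z) + sg (j && k) *: (b ** (a ** z)) - (a ** b) ** z)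
  + sg (i && (j (+) k)) *:
    (a ** (b ** (x ** z)) + sg (j && k) *: (b ** (a ** (x ** z)))
     - (a ** b) ** (x ** z)).
Proof.
move=> hx ha hb.
have E1 := jordan_op z hx ha hb; have E2 := jordan_op z hx hb ha.
have := jordan_vec z hx ha hb; move: E1 E2.
rewrite (jordan_comm _ _ _ _ hb hx) (jordan_comm _ _ _ _ hb ha).
rewrite (jordan_comm _ _ _ _ ha (smul_homog _ _ _ _ hx hb)).
case: i {hx}; case: j {ha}; case: k {hb}; signs => E1 E2 E3.
(* The parities decide the two relative signs of the combination. *)
all: first
  [ zmod_using (congr2 +%R (congr2 +%R E1 E2) E3)
  | zmod_using (congr2 (fun u v => u - v) (congr2 +%R E1 E2) E3)
  | zmod_using (congr2 +%R (congr2 (fun u v => u - v) E1 E2) E3)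
  | zmod_using
      (congr2 (fun u v => u - v) (congr2 (fun u v => u - v) E1 E2) E3) ].
Qed.

End JordanIdentities.

(** * Linear spans and Lie subsuperalgebras *)

Section Lspan.
Context (K : fieldType) (V : lmodType K).
Implicit Types (P S : set V) (x y : V).

Lemma lspan_incl P x : P x -> lspan P x.
Proof.
move=> Px; exists 1%N, (fun=> 1), (fun=> x); split=> //.
by rewrite big_ord1 scale1r.
Qed.

Lemma lspan0 P : lspan P 0.
Proof. by exists 0%N, (fun=> 0), (fun=> 0); split=> [[]//|]; rewrite big_ord0. Qed.

Lemma lspanP P a x y : lspan P x -> lspan P y -> lspan P (a *: x + y).
Proof.
move=> [m [c [v [Pv ->]]]] [n [d [w [Pw ->]]]].
exists (m + n)%N,
  (fun k => match fintype.split k with inl i => a * c i | inr i => d i end),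
  (fun k => match fintype.split k with inl i => v i | inr i => w i end).
split=> [k|]; first by case: (fintype.split k).
rewrite big_split_ord /= scaler_sumr; congr (_ + _); apply: eq_bigr => i _.
  by rewrite (unsplitK (inl i)) scalerA.
by rewrite (unsplitK (inr i)).
Qed.

Lemma lspanD P x y : lspan P x -> lspan P y -> lspan P (x + y).
Proof. by rewrite -{2}[x]scale1r; exact: lspanP. Qed.

Lemma lspan_min P S : S 0 -> (forall a x y, S x -> S y -> S (a *: x + y)) ->
  P `<=` S -> lspan P `<=` S.
Proof.
move=> S0 SP PS _ [n [c [v [Pv ->]]]].
by elim/big_rec: _ => // i x _ Sx; apply: SP => //; exact/PS.
Qed.

End Lspan.

Lemma lspan_lie_sub (K : fieldType) (L : lieSuperType K) (P : set L) :
  (forall x, P x -> exists p, homog p x) ->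
  (forall x y, P x -> P y -> lspan P [lie x, y]) -> lie_sub (lspan P).
Proof.
move=> Ph Plie; have l0 := lspan0 P; have lP := @lspanP _ _ P.
have lie0l (y : L) : [lie 0, y] = 0.
  apply: (addrI [lie 0, y]); rewrite addr0.
  by have := lie_linear_l y 1 0 0; rewrite !scale1r addr0 => <-.
have lie0r (x : L) : [lie x, 0] = 0.
  apply: (addrI [lie x, 0]); rewrite addr0.
  by have := lie_linear_r x 1 0 0; rewrite !scale1r addr0 => <-.
split=> //.
- move=> i; apply: lspan_min => /=.
  + by rewrite raddf0.
  + by move=> a x y; rewrite linearP; exact: lP.
  move=> x Px; have [p hx] := Ph x Px; rewrite (part_homogN _ hx).
  by case: eqP => // _; exact: lspan_incl.
- move=> x y lx; move: x lx y.
  apply: (@lspan_min _ _ P [set x | forall y, lspan P y -> lspan P [lie x, y]]).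
  + by move=> y _ /=; rewrite lie0l.
  + move=> a x y hx hy z lz /=; rewrite lie_linear_l.
    by apply: lP; [exact: hx|exact: hy].
  move=> x Px /=; apply: lspan_min => /=.
  + by rewrite lie0r.
  + by move=> a y z; rewrite lie_linear_r; exact: lP.
  by move=> y; exact: Plie.
Qed.

(** An even linear map restricting to a bracket-preserving bijection between two
   Lie subsuperalgebras induces an isomorphism between them. *)
Lemma lie_iso_sub (K : fieldType) (L M : lieSuperType K) (S : set L) (T : set M)
    (hS : lie_sub S) (hT : lie_sub T) (f : {linear L -> M}) (g : M -> L) :
  (forall x, S x -> T (f x)) -> (forall y, T y -> S (g y)) ->
  (forall x, S x -> g (f x) = x) -> (forall y, T y -> f (g y) = y) ->
  (forall i x, f (part i x) = part i (f x)) ->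
  (forall x y, S x -> S y -> f [lie x, y] = [lie f x, f y]) ->
  lie_iso (sub_lie hS) (sub_lie hT).
Proof.
move=> fT gS fK gK fpart flie.
have inS (x : sub_lie hS) : S (val x) by exact/set_mem/(valP x).
have inT (y : sub_lie hT) : T (val y) by exact/set_mem/(valP y).
pose F (x : sub_lie hS) : sub_lie hT := Sub (f (val x)) (mem_set (fT _ (inS x))).
pose G (y : sub_lie hT) : sub_lie hS := Sub (g (val y)) (mem_set (gS _ (inT y))).
have Flin : linear F by move=> a x y; apply: val_inj; rewrite /= !linearP.
pose Fl : {linear sub_lie hS -> sub_lie hT} :=
  HB.pack F (GRing.isLinear.Build K _ _ _ F Flin).
exists Fl; split.
- exists G => x; apply: val_inj => /=; first exact/fK/inS.
  exact/gK/inT.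
- by move=> i x; apply: val_inj; exact: fpart.
- by move=> x y; apply: val_inj; exact: flie.
Qed.

(** * Derivations and the U-operators *)

Section Structure.
Context (K : fieldType) (V : jordanSuperType K).
Implicit Types (x y z a b : V) (X Y D : End V).
Local Notation "'sg' b" := ((-1) ^+ b : K) (at level 8, b at level 1).

Lemma part_split x : (part false x : V) + (part true x : V) = x :> V.
Proof. exact: part_sum. Qed.

(** The homogeneous derivations of degree p, homogeneity being stated apart. *)
Definition derivation (p : bool) D := forall i j x y, homog i x -> homog j y ->
  D (x ** y) = D x ** y + sg (i && p) *: (x ** D y).

Lemma derivationE p D i x y : derivation p D -> homog i x ->
  D (x ** y) = D x ** y + sg (i && p) *: (x ** D y).
Proof.
move=> dD hx; rewrite -(part_split y) !linearD /=.
by rewrite !(dD _ _ _ _ hx (part_homog _ y)) addrACA.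
Qed.

Lemma derivationN p D : derivation p D -> derivation p (- D).
Proof.
move=> dD i j x y hx hy; rewrite !EndoppE (dD _ _ _ _ hx hy).
by rewrite smulNl smulNr scalerN opprD.
Qed.

Lemma derivationD p D D' :
  derivation p D -> derivation p D' -> derivation p (D + D').
Proof.
move=> dD dD' i j x y hx hy; rewrite !EndaddE (dD _ _ _ _ hx hy).
by rewrite (dD' _ _ _ _ hx hy) smulDl smulDr scalerDr addrACA.
Qed.

Lemma derivation_lie p q D D' : homog p D -> homog q D' ->
  derivation p D -> derivation q D' -> derivation (p (+) q) [lie D, D'].
Proof.
move=> hD hD' dD dD' i j x y hx hy; rewrite !(supercommE _ hD hD').
rewrite (derivationE _ dD' hx) (derivationE _ dD hx) !linearD !linearZ /=.
rewrite (derivationE _ dD hx) (derivationE _ dD (homog_End hD' hx)).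
rewrite (derivationE _ dD' hx) (derivationE _ dD' (homog_End hD hx)).
by case: p {hD dD}; case: q {hD' dD'}; case: i {hx}; signs; zmod.
Qed.

Lemma derivation_lie_Lop p q x y : homog p x -> homog q y ->
  derivation (p (+) q) [lie Lop x, Lop y].
Proof.
move=> hx hy i j a b ha hb.
rewrite !(supercommE _ (homog_Lop hx) (homog_Lop hy)) /=.
by rewrite (lie_Lop_derivation _ hx hy ha) (andbC i).
Qed.

(** U_(a,b) = 2 (L_a L_b + (-1)^(|a||b|) L_b L_a - L_(ab)); in this form the sign
   does not depend on the operand z, which need not be homogeneous. *)
Lemma Uop_Lop i j a b z : homog i a -> homog j b ->
  Uop a b z = 2 *: (a ** (b ** z) + sg (i && j) *: (b ** (a ** z)) - (a ** b) ** z).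
Proof.
move=> ha hb.
have hM p q (u v : V) : homog p u -> homog q v -> homog (p (+) q) (u ** v).
  exact: smul_homog.
have H k c : homog k c -> sg (j && k) *: triple a c b =
   2 *: (a ** (b ** c) + sg (i && j) *: (b ** (a ** c)) - (a ** b) ** c).
  move=> hc; rewrite (tripleE _ ha hc) scalerA mulrC -scalerA; congr (_ *: _).
  rewrite (jordan_comm _ _ _ _ (hM _ _ _ _ ha hc) hb) (jordan_comm _ _ _ _ hc hb).
  rewrite (jordan_comm _ _ _ _ hc (hM _ _ _ _ ha hb)).
  by case: i {ha}; case: j {hb}; case: k {hc}; signs; zmod.
have -> : Uop a b z = \sum_(k : bool) sg (j && k) *: triple a (part k z) b.
  have t0 w : triple a w 0 = 0.
    by rewrite /triple !big_bool /= !(smulE, linear0, scaler0, addr0, subr0).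
  rewrite /Uop !big_bool /= !(part_homogN _ hb).
  by case: j {hb H} => /=; rewrite !t0 !scaler0 !(addr0, add0r).
under eq_bigr => k _ do rewrite (H k _ (part_homog k z)).
rewrite big_bool /= -scalerDr -[z in RHS]part_split; congr (_ *: _).
by case: (i && j); signs; zmod.
Qed.

Lemma scale2 (W : lmodType K) (v : W) : 2 *: v = v + v.
Proof. by rewrite scaler_nat mulr2n. Qed.

(** The identity U_(X a, b) +- U_(a, X b) = X U_(a,b) +- U_(a,b) Y, with the signs
   that X and Y of parity p require; their parity is stated apart. *)
Definition Ucond (p : bool) X Y := forall i j a b, homog i a -> homog j b ->
  forall z, Uop (X a) b z + sg (p && i) *: Uop a (X b) z =
    X (Uop a b z) + sg (p && (i (+) j)) *: Uop a b (Y z).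

Lemma Ucond_Lop p x : homog p x -> Ucond p (Lop x) (Lop x).
Proof.
move=> hx i j a b ha hb z /=.
rewrite (Uop_Lop _ (smul_homog _ _ _ _ hx ha) hb) (Uop_Lop _ ha hb).
rewrite (Uop_Lop _ ha (smul_homog _ _ _ _ hx hb)) (Uop_Lop _ ha hb).
rewrite [in RHS]linearZ /= !scalerA ![_ * 2]mulrC -!scalerA -!scalerDr.
by congr (_ *: _); exact: Lop_fundamental.
Qed.

Lemma Ucond_derivation p D : homog p D -> derivation p D -> Ucond p D (- D).
Proof.
move=> hD dD i j a b ha hb z.
rewrite (Uop_Lop _ (homog_End hD ha) hb) (Uop_Lop _ ha hb).
rewrite (Uop_Lop _ ha (homog_End hD hb)) (Uop_Lop _ ha hb).
rewrite [in RHS]linearZ /= !scalerA ![_ * 2]mulrC -!scalerA -!scalerDr.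
congr (_ *: _); rewrite !linearD !linearN !linearZ /=.
rewrite !(derivationE _ dD ha, derivationE _ dD hb).
rewrite (derivationE _ dD (smul_homog _ _ _ _ ha hb)) !(derivationE _ dD ha).
by case: p {hD dD}; case: i {ha}; case: j {hb}; signs; zmod.
Qed.

Lemma UopDl i j a a' b z : homog i a -> homog i a' -> homog j b ->
  Uop (a + a') b z = Uop a b z + Uop a' b z.
Proof.
move=> ha ha' hb; rewrite (Uop_Lop _ (homogD ha ha') hb).
rewrite (Uop_Lop _ ha hb) (Uop_Lop _ ha' hb) -scalerDr; congr (_ *: _).
by case: (i && j); signs; zmod.
Qed.

Lemma UopDr i j a b b' z : homog i a -> homog j b -> homog j b' ->
  Uop a (b + b') z = Uop a b z + Uop a b' z.
Proof.
move=> ha hb hb'.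
rewrite (Uop_Lop _ ha (homogD hb hb')) (Uop_Lop _ ha hb) (Uop_Lop _ ha hb').
rewrite -scalerDr; congr (_ *: _).
by case: (i && j); signs; zmod.
Qed.

Lemma UopD i j a b z z' : homog i a -> homog j b ->
  Uop a b (z + z') = Uop a b z + Uop a b z'.
Proof.
move=> ha hb; rewrite !(Uop_Lop _ ha hb) -scalerDr; congr (_ *: _).
by case: (i && j); signs; zmod.
Qed.

Lemma UcondD p X X' Y Y' : homog p X -> homog p X' ->
  Ucond p X Y -> Ucond p X' Y' -> Ucond p (X + X') (Y + Y').
Proof.
move=> hX hX' c c' i j a b ha hb z; rewrite !EndaddE.
rewrite (UopDl _ (homog_End hX ha) (homog_End hX' ha) hb).
rewrite (UopDr _ ha (homog_End hX hb) (homog_End hX' hb)) (UopD _ _ ha hb).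
by rewrite !scalerDr addrACA (c _ _ _ _ ha hb) (c' _ _ _ _ ha hb) addrACA.
Qed.

(** The decomposition X = L_x + D of a homogeneous element of the structure
   algebra; when V is unital, x = X(e). *)
Definition str_homog (p : bool) X := exists x D,
  [/\ homog p x, homog p D, derivation p D & X = Lop x + D].

Lemma str_homogW p X : str_homog p X -> homog p X.
Proof. by move=> [x [D [hx hD _ ->]]]; exact/homogD/hD/homog_Lop. Qed.

(** [L_x + D, L_y + D'] = L_(D y - (+-) D' x) + ([L_x, L_y] + [D, D']). *)
Lemma str_homog_lie p q X Y : str_homog p X -> str_homog q Y ->
  str_homog (p (+) q) [lie X, Y].
Proof.
move=> [x [D [hx hD dD ->]]] [y [D' [hy hD' dD' ->]]].
exists (D y - sg (p && q) *: D' x), ([lie Lop x, Lop y] + [lie D, D']).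
have hLx := homog_Lop hx; have hLy := homog_Lop hy.
split.
- apply: homogD; first exact: homog_End.
  by apply/homogN/homogZ; rewrite addbC; exact: homog_End.
- by apply: homogD; exact: lie_homog.
- by apply: derivationD; [exact: derivation_lie_Lop|exact: derivation_lie].
apply: EndP => w.
rewrite (EndaddE (Lop _)) (EndaddE [lie Lop x, Lop y])
  (supercommE _ hLx hLy) (supercommE _ hD hD').
rewrite (supercommE _ (homogD hLx hD) (homogD hLy hD')) !EndaddE /=.
rewrite !linearD /= (derivationE _ dD hy) (derivationE _ dD' hx).
by case: p {hx hD dD hLx}; case: q {hy hD' dD' hLy}; signs; zmod.
Qed.

Section Unital.
Context (e : V) (he : is_unity e).

Let e1x x : e ** x = x. Proof. by case: (he x). Qed.
Let x1e x : x ** e = x. Proof. by case: (he x). Qed.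

(** The odd part of e multiplies every homogeneous vector to 0. *)
Lemma homog_unity : homog false e.
Proof.
have odd0 : part true e ** e = 0.
  rewrite -{2}(part_split e) linearD /=.
  suff H i x : homog i x -> part true e ** x = 0.
    by rewrite !(H _ _ (part_homog _ _)) addr0.
  move=> hx; have := e1x x; rewrite -{1}(part_split e) smulDl.
  move/(congr1 (part (~~ i))); rewrite linearD.
  have := smul_homog _ _ _ _ (part_homog false e) hx.
  have := smul_homog _ _ _ _ (part_homog true e) hx.
  rewrite /= => h1 h0; rewrite (part_homogN _ h0) (part_homogN _ hx).
  have -> : (i == ~~ i) = false by case: (i).
  by rewrite add0r h1.
rewrite /homog /= -{2}(part_split e).
by move: odd0; rewrite x1e => ->; rewrite addr0.
Qed.

Lemma derivation_unity p D : derivation p D -> D e = 0.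
Proof.
move=> dD; have := dD _ _ _ _ homog_unity homog_unity.
by rewrite x1e e1x x1e /= scale1r -{1}[D e]addr0 => /addrI.
Qed.

Lemma XstarE X w : Xstar e X w = - X w + 2 *: (X e ** w).
Proof. by []. Qed.

Lemma Xstar_str x p D : derivation p D -> Xstar e (Lop x + D) = Lop x - D.
Proof.
move=> dD; apply: EndP => w; rewrite XstarE (EndaddE _ D e) (derivation_unity dD).
by rewrite addr0 /= x1e scale2; zmod.
Qed.

Lemma Xstar_linear : linear (Xstar e : End V -> End V).
Proof.
move=> a X Y; apply: EndP => w.
rewrite XstarE [RHS]EndaddE EndscaleE !XstarE /= smulDl smulZl !scalerDr scalerN opprD.
by rewrite !scalerA (mulrC 2) addrACA.
Qed.

(** X |-> X^* is a morphism to the opposite Lie superalgebra. *)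
Lemma Xstar_lie p q X Y : str_homog p X -> str_homog q Y ->
  Xstar e [lie X, Y] = - [lie Xstar e X, Xstar e Y].
Proof.
move=> sX sY; move: (sX) (sY) => [x [D [hx hD dD eX]]] [y [D' [hy hD' dD' eY]]].
rewrite eX eY (Xstar_str _ dD) (Xstar_str _ dD').
have hLx := homog_Lop hx; have hLy := homog_Lop hy.
apply: EndP => w; rewrite XstarE EndoppE.
rewrite !(supercommE _ (homogD hLx hD) (homogD hLy hD')).
rewrite (supercommE _ (homogD hLx (homogN hD)) (homogD hLy (homogN hD'))).
rewrite !EndaddE !EndoppE /= !x1e (derivation_unity dD) (derivation_unity dD').
rewrite ?(linearD D) ?(linearD D') ?(linearN D) ?(linearN D') /=.
rewrite (linear0 D) (linear0 D') !addr0 scale2.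
rewrite !(derivationE _ dD hy) !(derivationE _ dD' hx) (jordan_comm _ _ _ _ hx hy).
by case: p {hx hD dD hLx sX}; case: q {hy hD' dD' hLy sY}; signs; zmod.
Qed.

Lemma Xstar_cond p X : str_homog p X ->
  Ucond p X (Xstar e X) /\ Ucond p (Xstar e X) X.
Proof.
move=> [x [D [hx hD dD ->]]]; rewrite (Xstar_str _ dD); split.
  by apply: UcondD (homog_Lop hx) hD (Ucond_Lop hx) (Ucond_derivation hD dD).
apply: UcondD (homog_Lop hx) (homogN hD) (Ucond_Lop hx) _.
rewrite -[X in Ucond _ _ X]opprK.
exact: Ucond_derivation (homogN hD) (derivationN dD).
Qed.

Lemma Xstar_homog p X : str_homog p X -> homog p (Xstar e X).
Proof.
move=> [x [D [hx hD dD ->]]]; rewrite (Xstar_str _ dD).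
exact: homogD (homog_Lop hx) (homogN hD).
Qed.

Lemma Uop_unity_r i a z : homog i a -> Uop a e z = 2 *: (a ** z).
Proof.
move=> ha; rewrite (Uop_Lop _ ha homog_unity) andbF expr0 scale1r.
by rewrite !(e1x, x1e) addrK.
Qed.

Lemma Uop_unity_l i a z : homog i a -> Uop e a z = 2 *: (a ** z).
Proof.
move=> ha; rewrite (Uop_Lop _ homog_unity ha) expr0 scale1r.
by rewrite !(e1x, x1e) addrK.
Qed.

Hypothesis K2 : 2 != 0 :> K.

(** Taking b = e: X - L_(X e) then satisfies the condition with its opposite and
   kills e, and the condition becomes the Leibniz rule. *)
Lemma Ucond_str_homog p X : homog p X -> Ucond p X (Xstar e X) -> str_homog p X.
Proof.
move=> hX cX.
have hx : homog p (X e) by rewrite -[p]addbF; exact: homog_End homog_unity.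
have hL := homog_Lop hx; have hNx := homogN hx.
have LN : Lop (- X e) = - Lop (X e) :> End V.
  by apply: EndP => w; rewrite EndoppE /= smulNl.
pose D : End V := X - Lop (X e).
have hD : homog p D by exact: homogD hX (homogN hL).
have De : D e = 0 by rewrite EndaddE EndoppE /= x1e subrr.
have cD : Ucond p D (- D).
  have -> : - D = Xstar e X + Lop (- X e).
    by apply: EndP => w; rewrite LN /D EndaddE XstarE /= scale2; zmod.
  rewrite /D -LN; apply: (UcondD hX _ cX (Ucond_Lop hNx)).
  exact: homog_Lop.
have eX : X = Lop (X e) + D by rewrite /D addrC subrK.
exists (X e), D; split=> //; clearbody D.
move=> i j x y hx' hy.
have := cD _ _ _ _ hx' homog_unity y.
rewrite De !(Uop_unity_r _ hx') (Uop_unity_r _ (homog_End hD hx')) EndoppE.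
have -> : Uop x 0 y = 0.
  have h0 : homog false (0 : V) by rewrite /homog/= linear0.
  by rewrite (Uop_Lop _ hx' h0) !(smulE, scaler0, addr0, subr0).
rewrite scaler0 addr0 addbF linearZ /= andbC smulNr.
rewrite scalerA mulrC -scalerA -scalerDr => /(scalerI K2) ->.
by rewrite scalerN subrK.
Qed.

(** Taking a = b = e determines Y from X. *)
Lemma Ucond_Xstar p X Y : homog p X -> Ucond p X Y -> Y = Xstar e X.
Proof.
move=> hX cXY; have h1 := homog_unity; apply: EndP => z.
have := cXY _ _ _ _ h1 h1 z.
rewrite (Uop_unity_r _ (homog_End hX h1)) (Uop_unity_l _ (homog_End hX h1)).
rewrite !(Uop_unity_r _ h1) !e1x andbF expr0 !scale1r linearZ /= -!scalerDr.
move=> /(scalerI K2) E; rewrite scale2.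
by zmod_using E.
Qed.

End Unital.
End Structure.

(** * The three structure algebras *)

Section StructureIsos.
Context (K : fieldType) (V : jordanSuperType K) (e : V) (he : is_unity e).
Hypothesis K2 : 2 != 0 :> K.

Local Notation strh := [set X : End V | exists p, str_homog p X].

Lemma strt_lspan : strt e = lspan strh.
Proof.
rewrite /strt; congr lspan; apply/seteqP; split => X /= [p].
  by move=> hX cX; exists p; exact: (Ucond_str_homog he K2 hX cX).
move=> sX; exists p; first exact: str_homogW sX.
by have [cX _] := Xstar_cond he sX; exact: cX.
Qed.

Lemma str_lspan : str V = lspan strh.
Proof.
apply/seteqP; split => [_ [x [D [DD ->]]]|].
  have d0 q : derivation q (0 : End V).
    by move=> i j y z _ _; rewrite !End0E !smulE scaler0 addr0.
  have h0 q : homog q (0 : End V) by rewrite /homog/= linear0.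
  apply: lspanD; last first.
    move: D DD; apply: lspan_min; first exact: lspan0.
      by move=> a D D'; exact: lspanP.
    move=> D [p hD dD]; apply: lspan_incl; exists p, 0, D; split=> //.
      by rewrite /homog/= linear0.
    by apply: EndP => w; rewrite EndaddE /= smul0l add0r.
  have -> : Lop x = Lop (part false x) + Lop (part true x).
    by apply: EndP => w; rewrite EndaddE /= -smulDl part_split.
  apply: lspanD; apply: lspan_incl.
    by exists false, (part false x), 0; rewrite addr0; split=> //; exact: part_homog.
  by exists true, (part true x), 0; rewrite addr0; split=> //; exact: part_homog.
apply: lspan_min.
- exists 0, 0; split; first exact: lspan0.
  by apply: EndP => w; rewrite EndaddE /= smul0l addr0.
- move=> a _ _ [x [D [DD ->]]] [y [D' [DD' ->]]].
  exists (a *: x + y), (a *: D + D'); split; first exact: lspanP.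
  apply: EndP => w; rewrite !EndE /= smulDl smulZl scalerDr.
  by rewrite addrACA.
move=> _ [p [x [D [hx hD dD ->]]]]; exists x, D; split=> //.
by apply: lspan_incl; exists p.
Qed.

Lemma strw_lspan : strw V =
  lspan [set XY : End V * lie_op (End V) |
         exists2 p, str_homog p XY.1 & XY.2 = Xstar e XY.1].
Proof.
rewrite /strw; congr lspan; apply/seteqP; split => [[X Y] /= [p]|[X Y] /= [p]].
  move=> [hX hY] cXY.
  have cX : Ucond p X Y by move=> i j a b ha hb; case: (cXY i j a b ha hb).
  have eY := Ucond_Xstar he K2 hX cX; exists p => //.
  by apply: (Ucond_str_homog he K2 hX); rewrite -eY.
move=> sX ->; exists p; first by split; [exact: str_homogW sX|exact: Xstar_homog].
move=> i j a b ha hb; have [c1 c2] := Xstar_cond he sX.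
by split; [exact: c1|exact: c2].
Qed.

Lemma strh_lie_sub : lie_sub (lspan strh).
Proof.
apply: lspan_lie_sub => [X [p sX]|X Y [p sX] [q sY]].
  by exists p; exact: str_homogW sX.
by apply: lspan_incl; exists (p (+) q); exact: str_homog_lie.
Qed.

Lemma strw_lie_sub : lie_sub (strw V).
Proof.
rewrite strw_lspan.
apply: lspan_lie_sub => [[X Y] /= [p sX ->]|[X X'] [Y Y'] /= [p sX ->] [q sY ->]].
  by exists p; congr pair; [exact: str_homogW sX|exact: Xstar_homog].
apply: lspan_incl; exists (p (+) q); first exact: str_homog_lie.
by rewrite /= (Xstar_lie he sX sY).
Qed.

Lemma strw_sub : strw V `<=` [set XY | strt e XY.1 /\ XY.2 = Xstar e XY.1].
Proof.
rewrite strw_lspan strt_lspan; apply: lspan_min.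
- split; first exact: lspan0.
  apply: EndP => w; by rewrite XstarE /= smul0l scaler0 addr0 oppr0.
- move=> a [X X'] [Y Y'] /= [sX ->] [sY ->]; split; first exact: lspanP.
  by rewrite Xstar_linear.
by move=> [X Y] /= [p sX ->]; split=> //; apply: lspan_incl; exists p.
Qed.

(** With [strw_sub]: str_w is the graph of X |-> X^*. *)
Lemma strt_strw X : strt e X -> strw V (X, Xstar e X).
Proof.
rewrite strw_lspan strt_lspan.
apply: (@lspan_min _ _ _ [set X | lspan _ (X, Xstar e X : lie_op (End V))]).
- rewrite /=; have -> : Xstar e 0 = 0 :> End V; last exact: lspan0.
  by apply: EndP => w; rewrite XstarE /= smul0l scaler0 addr0 oppr0.
- by move=> a Y Z hY hZ /=; rewrite Xstar_linear; exact: lspanP hY hZ.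
by move=> Y [p sY]; apply: lspan_incl; exists p.
Qed.

End StructureIsos.

Theorem lemma3p16 (K : fieldType)
    (hK2 : 2%N \notin [pchar K]%R) (hK3 : 3%N \notin [pchar K]%R)
    (V : jordanSuperType K) (e : V) (he : is_unity e) :
  exists (hw : lie_sub (strw V)) (ht : lie_sub (strt e)) (hs : lie_sub (str V)),
    lie_iso (sub_lie hw) (sub_lie ht) /\ lie_iso (sub_lie ht) (sub_lie hs).
Proof.
have K2 : 2 != 0 :> K by move: hK2; rewrite inE /=.
have ht : lie_sub (strt e).
  by rewrite (strt_lspan he K2); exact: strh_lie_sub.
have eqst : str V = strt e by rewrite (strt_lspan he K2) str_lspan.
have hw := strw_lie_sub he K2.
rewrite eqst; exists hw, ht, ht; split; last first.
  by apply: (@lie_iso_sub _ _ _ _ _ _ _ (idfun : {linear _ -> _}) id).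
pose f : {linear (End V * lie_op (End V))%type -> End V} := fst.
apply: (@lie_iso_sub _ _ _ _ _ _ _ f (fun X => (X, Xstar e X))).
- by move=> XY /(strw_sub he K2) [].
- exact: strt_strw.
- by move=> [X Y] /(strw_sub he K2) [_ /= ->].
- by [].
- by [].
- by [].
Qed.
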